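(* Let $G$ be a tree on $k$ vertices and $n\ge 1$. Then $$\begin{aligned}\mathrm{Sz}(\Gamma^G_n)&=\frac{2(k-1)^2(2k^2-2k-1)}{k^3(2k-1)}\,2^nk^{2n}-\frac{4(k-1)^2}{k^2}\,nk^{2n}+\frac{4(k+1)(k-1)}{k^3}\,k^{2n}-\frac{4(k+1)(k-1)}{k(2k-1)}\,k^n\\&\quad+\left(\frac{4}{k^2}\,nk^{2n}-\frac{2(k^2+2)}{k^3(k-1)}\,k^{2n}+\frac{2(k+2)}{k^2(k-1)}\,k^n\right)\mathrm{Sz}(G).\end{aligned}$$
   Context: Let $G=(V,E)$ be a finite tree with vertex set $V$ of size $k$, and fix an orientation of each edge, so that each edge becomes an ordered pair $e=(s,t)$. Each oriented edge $e=(s,t)$ acts on the set $V^*$ of finite words over the alphabet $V$ by the recursive rule: $e(\emptyset)=\emptyset$, $e(sw)=t\,e(w)$, $e(tw)=sw$, and $e(xw)=xw$ for $x\in V\setminus\{s,t\}$ (words are read left to right, $w\in V^*$). This action preserves word length. For $n\ge 1$, the Schreier graph $\Gamma_n^G$ is the multigraph with vertex set $V^n$ having, for each $u\in V^n$ and each oriented edge $e$ of $G$, one edge joining $u$ and $e(u)$, labelled $e$ (a loop if $e(u)=u$). For vertices $u,v$ of a connected graph $H$, $n(u,v)$ is the number of vertices of $H$ strictly closer to $u$ than to $v$. The Szeged index is $\mathrm{Sz}(H)=\sum_{\{u,v\}}n(u,v)\,n(v,u)$, the sum over all non-loop edges $\{u,v\}$ of $H$, parallel edges counted with multiplicity (loops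 contribute nothing). *)

(* Defs.v *)
From mathcomp Require Import all_boot all_order all_algebra.
Set Implicit Arguments. Unset Strict Implicit. Unset Printing Implicit Defensive.

Section Defs.
Variable V : finType.

Fixpoint act_seq (e : V * V) (w : seq V) : seq V :=
  match w with
  | [::] => [::]
  | x :: w' =>
      if x == e.1 then e.2 :: act_seq e w'
      else if x == e.2 then e.1 :: w'
      else x :: w'
  end.

Lemma size_act_seq e w : size (act_seq e w) = size w.
Proof.
elim: w => [|x w IH] //=.
by case: ifP => _ /=; [rewrite IH | case: ifP].
Qed.

Definition act_tuple {n} (e : V * V) (u : n.-tuple V) : n.-tuple V :=
  Tuple (introT eqP (etrans (size_act_seq e u) (size_tuple u))).

Definition adjG (E : {set V * V}) : rel V :=
  [rel x y | ((x, y) \in E) || ((y, x) \in E)].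

Definition is_oriented_tree (E : {set V * V}) : Prop :=
  [/\ forall x, (x, x) \notin E,
      forall x y, (x, y) \in E -> (y, x) \notin E,
      forall x y, connect (adjG E) x y
    & forall c : seq V, uniq c -> 2 < size c -> ~~ cycle (adjG E) c].

Definition schreier_adj (n : nat) (E : {set V * V}) : rel (n.-tuple V) :=
  [rel u v | [exists e in E, (act_tuple e u == v) || (act_tuple e v == u)]].
End Defs.

Section Dist.
Variable T : finType.
Variable r : rel T.

Fixpoint ball (i : nat) (x : T) : {set T} :=
  match i with
  | 0 => [set x]
  | i'.+1 => ball i' x :|: [set y | [exists z in ball i' x, r z y || r y z]]
  end.

(* graph distance: least i with y in ball i x (equal to #|T| if unreachable) *)
Definition gdist (x y : T) : nat := find (fun i => y \in ball i x) (iota 0 #|T|).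

Definition ncloser (u v : T) : nat := #|[set w | gdist w u < gdist w v]|.
End Dist.

(* Szeged index of the tree (each edge counted once, via its orientation) *)
Definition SzTree (V : finType) (E : {set V * V}) : nat :=
  \sum_(e in E) ncloser (adjG E) e.1 e.2 * ncloser (adjG E) e.2 e.1.

(* Szeged index of the Schreier multigraph Gamma_n: one edge per (u, e),
   loops (e(u) = u) contributing nothing. *)
Definition SzSchreier (V : finType) (E : {set V * V}) (n : nat) : nat :=
  \sum_(u : n.-tuple V) \sum_(e in E | act_tuple e u != u)
     ncloser (@schreier_adj V n E) u (act_tuple e u)
     * ncloser (@schreier_adj V n E) (act_tuple e u) u.

(* Main.v *)
(* Fix an edge e = (s, t) of the tree, and let p be the number of vertices on
   the side of s and q = k - p.  A word factors as a R with a the longest prefix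
   over {s, t}; e acts on a as a binary odometer (s = 1, t = 0, lowest bit
   first) and fixes R, so its e-orbit is a cycle of length 2^|a|.  The Schreier
   graph is a cactus made of these cycles: it retracts onto each of them by a
   map that is constant on every edge outside the cycle.  Composing the
   retraction with a reflection of the cycle shows that the vertices closer to u
   than to e(u) are those that retract onto the half-cycle ending at u.
   Counting them gives n(u, e u) n(e u, u) = h (k^n - h) with h = k^(|a|-1),
   times p or q when the first |a|-1 letters of a are all s.  Summing over words
   gives an affine function of p q, and the sum of p q over the edges is
   Sz(G). *)

Require Import Defs.
From mathcomp Require Import all_boot all_order all_algebra.
From mathcomp Require Import ring lra zify.
Set Implicit Arguments.
Unset Strict Implicit.
Unset Printing Implicit Defensive.
Import GRing.Theory Num.Theory.

(** * Distances and reflections *)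

Section Distance.
Variables (T : finType) (r : rel T).
Hypothesis r_conn : forall x y, connect r x y.

Lemma ball_mono i j x : i <= j -> ball r i x \subset ball r j x.
Proof.
elim: j => [|j IH]; first by case: i.
rewrite leq_eqVlt => /predU1P[-> //|/IH sij].
exact: subset_trans sij (subsetUl _ _).
Qed.

Lemma ball_step i x y z :
  y \in ball r i x -> r y z || r z y -> z \in ball r i.+1 x.
Proof.
by move=> yi yz; rewrite inE; apply/orP; right; rewrite inE;
   apply/existsP; exists y; rewrite yi.
Qed.

Lemma path_ball x p : path r x p -> last x p \in ball r (size p) x.
Proof.
elim/last_ind: p => [|p y IH]; first by rewrite /= inE.
rewrite rcons_path last_rcons size_rcons => /andP[/IH pp py].
by apply: ball_step pp _; rewrite py.
Qed.

Lemma gdist_le i x y : y \in ball r i x -> gdist r x y <= i.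
Proof.
move=> yi; rewrite leqNgt; apply/negP => lt.
have iT : i < #|T|.
  by apply: leq_trans lt _; rewrite -[leqRHS](size_iota 0); apply: find_size.
by have := before_find 0 lt; rewrite nth_iota // yi.
Qed.

(** A duplicate-free path has length below [#|T|], so the search in [gdist] succeeds and does not
    return its default value. *)
Lemma mem_ball_gdist x y : y \in ball r (gdist r x y) x.
Proof.
have /connectP[p0 pp0 ->] := r_conn x y.
case/shortenP: pp0 => p pp up _.
have ps : size p < #|T|.
  by have := card_uniqP up; rewrite /= => <-; apply: max_card.
have h : has (fun i => last x p \in ball r i x) (iota 0 #|T|).
  by apply/hasP; exists (size p); rewrite ?mem_iota // path_ball.
by have := nth_find 0 h; rewrite nth_iota //; rewrite has_find size_iota in h.
Qed.

(* A geodesic from [H] to a vertex [v] outside is shortened by reflecting its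
   part beyond the last edge that enters the complement of [H]. *)
Lemma gdist_reflect (H : {set T}) (f : T -> T) :
    (forall x y, r x y -> f x = f y \/ r (f x) (f y) || r (f y) (f x)) ->
    (forall x y, r x y -> (x \in H) != (y \in H) -> f x = y /\ f y = x) ->
  forall w v, w \in H -> v \notin H -> gdist r w (f v) < gdist r w v.
Proof.
move=> fr fH w v wH vH.
suff ballf i y : y \notin H -> y \in ball r i w ->
    0 < i /\ f y \in ball r i.-1 w.
  have [d0 /gdist_le fd] := ballf _ _ vH (mem_ball_gdist w v).
  by rewrite -(prednK d0) ltnS.
elim: i y => [|i IH] y yH; first by rewrite inE => /eqP yw; rewrite yw wH in yH.
rewrite inE => /orP[/(IH _ yH)[i0 fy]|].
  by split=> //; apply: subsetP fy; apply: ball_mono; apply: leq_pred.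
rewrite inE => /existsP[z /andP[zi zy]]; split=> //=.
have [zH|zH] := boolP (z \in H).
  have -> // : f y = z.
  by case/orP: zy => /fH; rewrite zH (negbTE yH) => /(_ isT)[].
have [i0 fz] := IH _ zH zi; rewrite -(prednK i0).
have [eq|adj] : f z = f y \/ r (f z) (f y) || r (f y) (f z).
- case/orP: zy => /fr [->|]; [by left|by right|by left|by rewrite orbC; right].
- by rewrite -eq; apply: subsetP fz; apply: ball_mono; apply: leqnSn.
- exact: ball_step fz adj.
Qed.

(** Since [f] swaps [u] and [v], [gdist_reflect] makes the end on one's own side strictly nearer.
    Used for [H] and for its complement, this leaves no ties. *)
Lemma ncloser_reflect (H : {set T}) (f : T -> T) u v :
    (forall x y, r x y -> f x = f y \/ r (f x) (f y) || r (f y) (f x)) ->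
    (forall x y, r x y -> (x \in H) != (y \in H) -> f x = y /\ f y = x) ->
    r u v || r v u -> u \in H -> v \notin H ->
  ncloser r u v = #|H| /\ ncloser r v u = #|~: H|.
Proof.
move=> fr fH uv uH vH.
have [fu fv] : f u = v /\ f v = u.
  by case/orP: uv => /fH; rewrite uH (negbTE vH) => /(_ isT)[].
have lt1 w : w \in H -> gdist r w u < gdist r w v.
  by move=> wH; rewrite -{1}fv; apply: gdist_reflect fr fH _ _ wH vH.
have lt2 w : w \notin H -> gdist r w v < gdist r w u.
  move=> wH; rewrite -{1}fu.
  apply: (@gdist_reflect (~: H)) => //; rewrite ?inE ?negbK //.
  by move=> x y xy; rewrite !inE (inj_eq negb_inj); apply: fH.
split; apply: eq_card => w; rewrite !inE.
  by apply/idP/idP => [|/lt1//]; apply: contraLR => /lt2/ltnW; rewrite leqNgt.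
by apply/idP/idP => [|/lt2//]; apply: contraL => /lt1/ltnW; rewrite leqNgt.
Qed.

End Distance.

(** * Edge cuts of a tree *)

Section Tree.
Variables (V : finType) (E : {set V * V}).

Lemma adjG_sym (F : {set V * V}) : symmetric (adjG F).
Proof. by move=> x y; rewrite /adjG /= orbC. Qed.

Definition side (e : V * V) (x : V) := connect (adjG (E :\ e)) e.1 x.

Lemma side_fst e : side e e.1. Proof. exact: connect0. Qed.

Lemma side_edge e f : f \in E -> f != e -> side e f.1 = side e f.2.
Proof.
move=> fE fe; apply: same_connect_r; first exact/sym_connect_sym/adjG_sym.
by apply: connect1; rewrite /adjG /= -surjective_pairing !inE fE fe.
Qed.

Hypothesis treeE : is_oriented_tree E.

(** A path between the ends of [e] that avoids [e] would close up with [e] to a cycle. *)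
Lemma side_snd e : e \in E -> ~~ side e e.2.
Proof.
case: treeE => irr asym _ acyc; case: e => s t stE; apply/negP => /=.
rewrite /side /= => /connectP[p0 pp0]; case/shortenP: pp0 => p pp up _ lastp.
have subE : subrel (adjG (E :\ (s, t))) (adjG E).
  move=> x y; rewrite /adjG /= !inE.
  by do 2!case: (_ \in E); rewrite ?orbT ?andbF.
(* A path without steps would make [e] a loop; a single step would need the reversed edge
   [(t, s)]. *)
have : 2 < size (s :: p).
  case: p pp {up} lastp => [|x [|y p]] //=.
    by move=> _ st; rewrite st in stE; have := irr s; rewrite stE.
  rewrite andbT /adjG /= !inE => + tx; rewrite tx in stE *.
  by rewrite eqxx /= (negbTE (asym _ _ stE)) andbF.
move=> /(acyc _ up)/negP; apply; rewrite /= rcons_path (sub_path subE pp) /=.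
by rewrite -lastp /adjG /= stE orbT.
Qed.

Lemma side_cross e x y : adjG E x y -> side e x != side e y ->
  (x, y) = e \/ (y, x) = e.
Proof.
case/orP=> xyE.
  have [-> | /(side_edge xyE) /= ->] := eqVneq (x, y) e; first by left.
  by rewrite eqxx.
have [-> | /(side_edge xyE) /= ->] := eqVneq (y, x) e; first by right.
by rewrite eqxx.
Qed.

Lemma ncloser_tree e : e \in E ->
  ncloser (adjG E) e.1 e.2 = #|[set x | side e x]| /\
  ncloser (adjG E) e.2 e.1 = #|~: [set x | side e x]|.
Proof.
case: (treeE) => _ _ conn _ eE; have sndF := negbTE (side_snd eE).
have adje : adjG E e.1 e.2 by rewrite /adjG /= -surjective_pairing eE.
(* Every vertex is sent to the end of [e] on the opposite side: edges inside a side collapse, and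
   [e], the only edge between the sides, is reversed. *)
apply: (@ncloser_reflect _ _ conn _ (fun x => if side e x then e.2 else e.1)).
- move=> x y _; case: (side e x); case: (side e y); try by [left].
    by right; rewrite adje orbT.
  by right; rewrite adje.
- move=> x y xy; rewrite !inE => ne.
  by case: (side_cross xy ne) => <- /= in sndF *; rewrite side_fst sndF.
- by rewrite adje.
- by rewrite inE side_fst.
- by rewrite inE sndF.
Qed.

(** Fix a root [r] and send each edge to its end away from [r]; this is a bijection onto the
    vertices other than [r]. *)
Lemma card_tree : #|E| = #|V|.-1.
Proof.
case: (treeE) => irr _ conn _.
have [V0|/card_gt0P[r _]] := posnP #|V|.
  by rewrite V0; apply/eqP; rewrite cards_eq0; apply/set0Pn => -[[x _] _];
     move: (card0_eq V0 x); rewrite inE.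
pose child e := if side e r then e.2 else e.1.
have side_child e : e \in E -> side e (child e) = ~~ side e r.
  rewrite /child => eE; case: ifP => _; last exact: side_fst.
  exact/negbTE/side_snd.
have child_inj : {in E &, injective child}.
  (* If [e] and [e'] had the same child, the set of vertices lying with [r] for both edges would be
     closed under adjacency: both ends of [e] lie away from [r] with respect to [e'], and
     conversely. It contains [r] but not the child, against connectivity. *)
  move=> e e' eE e'E ee'; apply/eqP/negPn/negP => ne.
  have closed : closed (adjG E)
      [pred x | (side e x == side e r) && (side e' x == side e' r)].
    suff step x y : (x, y) \in E ->
        (side e x == side e r) && (side e' x == side e' r)
        = (side e y == side e r) && (side e' y == side e' r).
      by move=> x y /orP[] /step; rewrite !inE.
    move=> xyE; set u := child e in ee'.
    have [xye|nxye] := eqVneq (x, y) e; have [xye'|nxye'] := eqVneq (x, y) e'.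
    - by rewrite -xye -xye' eqxx in ne.
    - have := side_edge xyE nxye' => /= e'xy; rewrite e'xy.
      have : side e' y = ~~ side e' r.
        rewrite -(side_child e' e'E) -ee' /u /child -xye /=.
        by case: ifP => _; rewrite ?e'xy.
      by move=> ->; case: (side e' r); rewrite !andbF.
    - have := side_edge xyE nxye => /= exy; rewrite exy.
      have : side e y = ~~ side e r.
        rewrite -(side_child e eE) -/u ee' /child -xye' /=.
        by case: ifP => _; rewrite ?exy.
      by move=> ->; case: (side e r).
    - by rewrite (side_edge xyE nxye) (side_edge xyE nxye').
  have := closed_connect closed (conn r (child e)).
  by rewrite !inE !eqxx side_child //; case: (side e r).
rewrite -(card_in_imset child_inj) -(cardsC1 r).
apply: eq_card => x; rewrite !inE; apply/imsetP/idP => [[e eE ->]|xr].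
  by apply/eqP => cr; have := side_child _ eE; rewrite cr; case: (side e r).
(* The preimage of [x] is the last edge of a simple path from [r] to [x]: the rest of the path
   avoids [x], hence this edge, so [r] lies on the side of its other end. *)
have /connectP[p0 pp0] := conn r x; case/shortenP: pp0 => p pp up _ lx.
elim/last_ind: p => [|p y _] in pp up lx *; first by rewrite lx eqxx in xr.
rewrite last_rcons in lx; subst y.
move: pp; rewrite rcons_path => /andP[pp lastx].
have [e eE elast] : exists2 e, e \in E &
    e = (last r p, x) \/ e = (x, last r p).
  case/orP: lastx => ?; first by exists (last r p, x) => //; left.
  by exists (x, last r p) => //; right.
have xp : x \notin r :: p.
  by move: up; rewrite -rcons_cons rcons_uniq => /andP[].
have side_r : side e r = side e (last r p).
  have ppath : path (adjG (E :\ e)) r p.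
    have sub : {in predC1 x &, forall a b, adjG E a b -> adjG (E :\ e) a b}.
      move=> a b; rewrite !inE => ax bx; rewrite /adjG /= !inE.
      by case: elast => ->;
        rewrite !xpair_eqE (negbTE ax) (negbTE bx) ?andbF /=.
    apply: (sub_in_path (P := predC1 x)) pp => //.
    by apply/allP => y yp; rewrite inE; apply: contraNneq xp => <-.
  apply: same_connect_r; first exact/sym_connect_sym/adjG_sym.
  by apply/connectP; exists p.
exists e => //; rewrite /child side_r.
have := side_snd eE; have := side_fst e.
by case: elast => -> /= h1 h2; rewrite ?h1 ?(negbTE h2).
Qed.

End Tree.

(** * The odometer and the retraction onto one of its orbits *)

Section Action.
Variable V : finType.
Implicit Types (f : V * V) (w a R : seq V).

Lemma act_cat f a R :
  act_seq f (a ++ R)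
  = act_seq f a ++ (if all (pred1 f.1) a then act_seq f R else R).
Proof.
elim: a => [|x a IH] //=; case: (x == f.1) => /=; first by rewrite IH.
by case: ifP.
Qed.

Lemma schreier_adjE n (E : {set V * V}) (u v : n.-tuple V) :
  reflect (exists2 e, e \in E & act_tuple e u = v \/ act_tuple e v = u)
    (@schreier_adj V n E u v).
Proof.
apply: (iffP existsP) => [[e /andP[eE h]]|[e eE h]]; exists e => //.
  by case/orP: h => /eqP; [left | right].
by rewrite eE /=; case: h => ->; rewrite eqxx ?orbT.
Qed.

Lemma schreier_sym n (E : {set V * V}) : symmetric (@schreier_adj V n E).
Proof. by move=> u v; apply: eq_existsb => e; rewrite orbC. Qed.

Lemma schreier_act n (E : {set V * V}) e (u : n.-tuple V) :
  e \in E -> @schreier_adj V n E u (act_tuple e u).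
Proof. by move=> eE; apply/schreier_adjE; exists e => //; left. Qed.

(** Since [e] only swaps the first letter of a word starting with [e.2], the first letter can be
    moved along the tree with the tail fixed ([head]). To let [e] act on the tail, the first letter
    is moved to [e.1], then [e] is applied, then the first letter is restored ([step]). *)
Lemma schreier_connected n (E : {set V * V}) :
  (forall x y, connect (adjG E) x y) ->
  forall u v : n.-tuple V, connect (@schreier_adj V n E) u v.
Proof.
move=> conn; have csym m := sym_connect_sym (@schreier_sym m E).
elim: n => [u v|n IH u v]; first by rewrite (tuple0 u) (tuple0 v).
have head x y (w : n.-tuple V) :
    connect (@schreier_adj V n.+1 E) [tuple of x :: w] [tuple of y :: w].
  have /connectP[p pp ->] := conn x y.
  elim: p x pp => [|z p IHp] x //= /andP[xz /IHp]; apply: connect_trans.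
  have edge s t : (s, t) \in E ->
      connect (@schreier_adj V n.+1 E) [tuple of t :: w] [tuple of s :: w].
    move=> stE; have [->|/negbTE ts] := eqVneq t s; first exact: connect0.
    apply: connect1; apply/schreier_adjE; exists (s, t) => //.
    by left; apply: val_inj; rewrite /= ts eqxx.
  by case/orP: xz => /edge; rewrite // csym.
have tails x y (w w' : n.-tuple V) : connect (@schreier_adj V n E) w w' ->
    connect (@schreier_adj V n.+1 E) [tuple of x :: w] [tuple of y :: w'].
  case/connectP=> p pp ->.
  elim: p w pp => [|w1 p IHp] w /=; first by move=> _; apply: head.
  case/andP=> ww1 /IHp; apply: connect_trans.
  have step e (w2 w3 : n.-tuple V) : e \in E -> act_tuple e w2 = w3 ->
      connect (@schreier_adj V n.+1 E) [tuple of x :: w2] [tuple of x :: w3].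
    move=> eE <-; apply: connect_trans (head x e.1 w2) _.
    apply: connect_trans (head e.2 x _); apply: connect1.
    apply/schreier_adjE; exists e => //.
    by left; apply: val_inj; rewrite /= eqxx.
  by case/schreier_adjE: ww1 => e eE [] /(step e _ _ eE); rewrite // csym.
rewrite (tuple_eta u) (tuple_eta v); exact/tails/IH.
Qed.
End Action.

Fixpoint num (l : bitseq) : nat :=
  if l is b :: l' then b + (num l').*2 else 0.

Lemma num_lt (l : bitseq) : num l < 2 ^ size l.
Proof. by elim: l => //= b l; rewrite expnS; case: b; lia. Qed.

Lemma num_rcons (l : bitseq) b : num (rcons l b) = num l + 2 ^ size l * b.
Proof. by elim: l => /= [|c l ->]; rewrite ?expnS; lia. Qed.

Lemma num_true (l : bitseq) : (num l == (2 ^ size l).-1) = all id l.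
Proof.
elim: l => //= b l <-; have := num_lt l; rewrite expnS.
by case: b => /=; lia.
Qed.

Lemma num_nseq j b : num (nseq j b) = if b then (2 ^ j).-1 else 0.
Proof.
elim: j => [|j /= ->]; case: b => //; rewrite expnS.
by have := expn_gt0 2 j; lia.
Qed.

Section Odometer.
Variables (V : finType) (s t : V).
Hypothesis st : s != t.
Implicit Types (f : V * V) (w a : seq V).
Let e := (s, t).

(** The [j] lowest binary digits of [i], lowest first, with [s] for 1 and [t] for 0. Higher digits
    are dropped, so increasing [i] runs around the orbit cyclically. *)
Fixpoint word (j i : nat) : seq V :=
  if j is j'.+1 then (if odd i then s else t) :: word j' i./2 else [::].

Definition clean : pred V := pred2 s t.

Definition fixed_by_st (R : seq V) : bool :=
  if R is z :: _ then ~~ clean z else true.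

Lemma size_word j i : size (word j i) = j.
Proof. by elim: j i => //= j IH i; rewrite IH. Qed.

Lemma act_word j i : act_seq e (word j i) = word j i.+1.
Proof.
elim: j i => //= j IH i; case: (boolP (odd i)) => oi /=.
  by rewrite eqxx IH uphalf_half oi add1n.
by rewrite eq_sym (negbTE st) eqxx /= uphalf_half (negbTE oi).
Qed.

Lemma clean_word j i : all clean (word j i).
Proof.
elim: j i => //= j IH i; rewrite IH andbT /clean /=.
by case: ifP => _; rewrite eqxx ?orbT.
Qed.

Lemma num_word j i : num (map (pred1 s) (word j i)) = i %% 2 ^ j.
Proof.
elim: j i => [|j IH] i /=; first by rewrite modn1.
rewrite IH (_ : (if odd i then s else t) == s = odd i); last first.
  by case: ifP => _; rewrite ?eqxx // eq_sym (negbTE st).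
have eqi : i = i./2 %/ 2 ^ j * (2 * 2 ^ j) + (odd i + (i./2 %% 2 ^ j).*2).
  have := divn_eq i./2 (2 ^ j); have := odd_double_half i.
  by rewrite mulnCA; lia.
have lt : i./2 %% 2 ^ j < 2 ^ j by rewrite ltn_pmod ?expn_gt0.
rewrite expnS [in RHS]eqi modnMDl [RHS]modn_small //.
by case: (odd i); rewrite ?add0n ?add1n -muln2; lia.
Qed.

Lemma word_num (a : seq V) : all clean a ->
  word (size a) (num (map (pred1 s) a)) = a.
Proof.
elim: a => //= x a IH /andP[xc ac].
rewrite oddD odd_double addbF halfD odd_double andbF add0n doubleK.
rewrite (_ : (_ == s)./2 = 0) ?add0n ?IH //; last by case: eqP.
by case/orP: xc => /eqP->; rewrite ?eqxx // eq_sym (negbTE st).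
Qed.

Lemma word_mod j i : word j (i %% 2 ^ j) = word j i.
Proof. by rewrite -num_word -{1}(size_word j i) word_num ?clean_word. Qed.

Variable sd : pred V.
Hypotheses (sd_s : sd s) (sd_t : ~~ sd t).

Lemma sd_clean x : clean x -> sd x = (x == s).
Proof.
by case/orP => /eqP->; rewrite ?eqxx ?sd_s // (negbTE sd_t) eq_sym (negbTE st).
Qed.

Definition last_side (w : seq V) (d : bool) : bool :=
  foldl (fun d x => if clean x then d else sd x) d w.

(* The orbit point onto which [w] retracts: its i-th bit is the side of the last
   letter of [w] outside {s, t} after position i, or of w_i if there is none. *)
Fixpoint proj (w : seq V) : bitseq :=
  if w is x :: w' then last_side w' (sd x) :: proj w' else [::].

Lemma size_proj w : size (proj w) = size w.
Proof. by elim: w => //= x w ->. Qed.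

Lemma last_side_clean w d : all clean w -> last_side w d = d.
Proof. by elim: w d => //= x w IH d /andP[-> /IH]. Qed.

Lemma last_side_const w d d' : ~~ all clean w -> last_side w d = last_side w d'.
Proof. by elim: w d d' => //= x w IH d d'; case: (clean x) => //= /IH. Qed.

Lemma proj_clean w : all clean w -> proj w = map (pred1 s) w.
Proof.
elim: w => //= x w IH /andP[xc wc].
by rewrite last_side_clean // IH // sd_clean.
Qed.

Lemma proj_rcons_clean w x :
  clean x -> proj (rcons w x) = rcons (proj w) (x == s).
Proof.
move=> xc; elim: w => [|y w /= ->] /=; first by rewrite sd_clean.
by congr cons; rewrite /last_side foldl_rcons xc.
Qed.

Lemma proj_rcons_unclean w x :
  ~~ clean x -> proj (rcons w x) = nseq (size w).+1 (sd x).
Proof.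
move=> xc; elim: w => [|y w /= ->] //=.
by congr cons; rewrite /last_side foldl_rcons (negbTE xc).
Qed.

(** As long as [f] rewrites letters, the running value stays [sd f.1] on both sides, whether or not
    these letters are clean; from there on the two words agree. *)
Lemma last_side_act f w : sd f.1 = sd f.2 ->
  last_side (act_seq f w) (sd f.1) = last_side w (sd f.1).
Proof.
move=> f12; elim: w => //= x w IH; case: (eqVneq x f.1) => [->|_] /=.
  by rewrite -f12 !if_same.
by case: (eqVneq x f.2) => [->|_] //=; rewrite -f12 !if_same.
Qed.

Lemma proj_act f w : sd f.1 = sd f.2 -> proj (act_seq f w) = proj w.
Proof.
move=> f12; elim: w => //= x w IH; case: (eqVneq x f.1) => [->|_] /=.
  by rewrite -f12 last_side_act // IH.
by case: (eqVneq x f.2) => [->|_] //=; rewrite -f12.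
Qed.

Lemma last_side_act_st w d : last_side (act_seq e w) d = last_side w d.
Proof.
elim: w d => //= x w IH d; case: (eqVneq x s) => [->|_] /=.
  by rewrite /clean /= !eqxx orbT.
by case: (eqVneq x t) => [->|_] //=; rewrite /clean /= !eqxx orbT.
Qed.

(** [e] changes only letters before the first unclean one, and the bits at these positions are
    decided by a later unclean letter. *)
Lemma proj_act_st w : ~~ all clean w -> proj (act_seq e w) = proj w.
Proof.
elim: w => //= x w IH; have sc : clean s by rewrite /clean /= eqxx.
have tc : clean t by rewrite /clean /= eqxx orbT.
case: (eqVneq x s) => [->|_] /=.
  rewrite sc /= => wu; rewrite last_side_act_st IH //.
  by rewrite (last_side_const (sd t) (sd s)).
case: (eqVneq x t) => [->|_] //=; rewrite tc /= => wu.
by rewrite (last_side_const (sd t) (sd s)).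
Qed.

Lemma proj_nseq j x b : sd x = b -> proj (nseq j x) = nseq j b.
Proof.
move=> <-; elim: j => //= j ->; congr cons.
by elim: j => //= j IH; rewrite if_same.
Qed.

Definition stop_side (R : seq V) : bool := if R is z :: _ then sd z else true.

Section Orbit.
(* The orbit under study consists of the words [a ++ R] with [a] a word of
   length [j] over [{s, t}]; the first letter of [R], if any, stops [e]. *)
Variables (j : nat) (R : seq V).
Hypothesis R_stop : fixed_by_st R.

(** Only an edge [f] other than [e] can change another tail into [R]. The prefix is then constantly
    [f.1], and the first letter of [R] is an end of [f], on the same side. So all words with another
    tail retract onto the orbit point with constant bits [stop_side R]. *)
Definition pos (w : seq V) : nat :=
  num (if drop j w == R then proj (take j w) else nseq j (stop_side R)).

Lemma pos_lt w : size w = j + size R -> pos w < 2 ^ j.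
Proof.
move=> sw; rewrite /pos; set l := (if _ then _ else _).
have <- : size l = j by rewrite /l; case: ifP => _;
  [rewrite size_proj size_takel // sw leq_addr | rewrite size_nseq].
exact: num_lt.
Qed.

Lemma act_R : act_seq e R = R.
Proof.
by case: R R_stop => //= z R'; rewrite negb_or => /andP[/negbTE-> /negbTE->].
Qed.

Lemma act_eqR w : (act_seq e w == R) = (w == R).
Proof.
apply/eqP/eqP => [|->]; last exact: act_R.
move: R_stop; case: R w => [|z R'] [|x w] //=.
  by case: ifP => // _; case: ifP.
rewrite negb_or => /andP[zs zt]; case: ifP => [_ [tz]|_].
  by rewrite tz eqxx in zt.
by case: ifP => // _ [sz]; rewrite sz eqxx in zs.
Qed.

Lemma drop_act f w : j <= size w ->
  drop j (act_seq f w)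
  = if all (pred1 f.1) (take j w) then act_seq f (drop j w) else drop j w.
Proof.
move=> jw; rewrite -{1}(cat_take_drop j w) act_cat drop_size_cat //.
by rewrite size_act_seq size_takel.
Qed.

Lemma take_act f w : j <= size w -> take j (act_seq f w) = act_seq f (take j w).
Proof.
move=> jw; rewrite -{1}(cat_take_drop j w) act_cat take_size_cat //.
by rewrite size_act_seq size_takel.
Qed.

Lemma pos_word i : pos (word j i ++ R) = i %% 2 ^ j.
Proof.
rewrite /pos drop_size_cat ?size_word // eqxx take_size_cat ?size_word //.
by rewrite proj_clean ?clean_word // num_word.
Qed.

Lemma word_pos w : size w = j + size R -> drop j w = R ->
  all clean (take j w) -> word j (pos w) ++ R = w.
Proof.
move=> sw dw cw; rewrite /pos dw eqxx proj_clean //.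
rewrite -{2}(cat_take_drop j w) dw; congr cat; rewrite -[RHS]word_num //.
by rewrite size_takel // sw leq_addr.
Qed.

(** Off the orbit, either the tail differs from [R] before and after the action, or the prefix has
    an unclean letter and [proj_act_st] applies. *)
Lemma pos_act_st w : size w = j + size R ->
  pos (act_seq e w) = pos w \/ word j (pos w) ++ R = w.
Proof.
move=> sw; have jw : j <= size w by rewrite sw leq_addr.
have [/andP[/eqP dw cw]|nC] := boolP ((drop j w == R) && all clean (take j w)).
  by right; apply: word_pos.
left; rewrite /pos drop_act // take_act //.
have -> : ((if all (pred1 e.1) (take j w) then act_seq e (drop j w)
           else drop j w) == R) = (drop j w == R).
  by case: ifP => // _; apply: act_eqR.
by case: ifP nC => //= _ /proj_act_st ->.
Qed.

Lemma pos_act f w : sd f.1 = sd f.2 -> size w = j + size R ->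
  pos (act_seq f w) = pos w.
Proof.
move=> f12 sw; have jw : j <= size w by rewrite sw leq_addr.
rewrite /pos drop_act // take_act // proj_act //.
(* The tail changes only after a prefix of letters [f.1], whose projection is constant. If the tail
   enters or leaves [R], the first letter of [R] is [f.1] or [f.2], so both branches of [pos]
   agree. *)
case: (boolP (all (pred1 f.1) (take j w))) => [/all_pred1P allf|_ //].
have projf : proj (take j w) = nseq j (sd f.1).
  rewrite allf (proj_nseq _ (erefl _)); congr nseq.
  by rewrite size_takel.
rewrite projf; case: (eqVneq (drop j w) R) => [->|dR].
  case: eqP => // /eqP; case: R => //= z R'.
  case: (eqVneq z f.1) => [-> //|_].
  by case: (eqVneq z f.2) => [->|_]; rewrite -?f12 ?eqxx.
case: eqP => // RE; move: dR; rewrite -RE /stop_side.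
case: (drop j w) => //= z R'.
case: (eqVneq z f.1) => [_|_]; first by rewrite f12.
by case: (eqVneq z f.2) => [->|_]; rewrite -?f12 ?eqxx.
Qed.

End Orbit.

End Odometer.

(* [half_arc m i y]: going down from [i] modulo [2 * m] one meets [y] in less
   than [m] steps; [i] and [y] are reduced modulo [2 * m]. *)
Definition half_arc (m i y : nat) : bool :=
  if y <= i then i - y < m else i + m < y.

Lemma half_arc_refl m i : 0 < m -> half_arc m i i.
Proof. by move=> m0; rewrite /half_arc leqnn subnn. Qed.

Lemma modS_lt M y : y < M -> y.+1 %% M = if y.+1 == M then 0 else y.+1.
Proof.
move=> yM; case: eqP => [->|ne]; first exact: modnn.
by rewrite modn_small //; lia.
Qed.

Lemma half_arc_succ m i :
  0 < m -> i < 2 * m -> ~~ half_arc m i (i.+1 %% (2 * m)).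
Proof.
by move=> m0 im; rewrite modS_lt // /half_arc; case: ifP; case: ifP; lia.
Qed.

(** Only two edges of the cycle join the half-arc to its complement, and they are those whose ends
    are swapped by the reflection taking [y] to [2 * i + 1 - y]. The summand [2 * m] avoids
    truncated subtraction. *)
Lemma half_arc_cross m i y : 0 < m -> i < 2 * m -> y < 2 * m ->
  half_arc m i y != half_arc m i (y.+1 %% (2 * m)) ->
  2 * i + 2 * m - y = y %[mod 2 * m].
Proof.
move=> m0 im ym; rewrite modS_lt // => ne.
(* The cases are [y = i + m], [y = i] and [y = i - m]. *)
suff [->|[->|->]] : 2 * i + 2 * m - y = y + 2 * m
  \/ (2 * i + 2 * m - y = y \/ 2 * i + 2 * m - y = y + 2 * (2 * m)).
- by rewrite modnDr.
- by [].
- by rewrite addnC modnMDl.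
move: ne; rewrite /half_arc.
by case: (y.+1 =P 2 * m); case: (leqP y i); case: (leqP 0 i);
   case: (leqP y.+1 i); lia.
Qed.

(** * Vertices closer to one end of an orbit edge *)

Section Closer.
Variables (V : finType) (E : {set V * V}) (s t : V) (sd : pred V).
Hypotheses (st : s != t) (sd_s : sd s) (sd_t : ~~ sd t).
Hypotheses (stE : (s, t) \in E).
Hypothesis sd_edge : forall f, f \in E -> f != (s, t) -> sd f.1 = sd f.2.
Hypothesis conn : forall x y, connect (adjG E) x y.
Variables (n j : nat) (R : seq V).
Hypothesis R_stop : fixed_by_st s t R.
Hypothesis nE : n = j.+1 + size R.

Let M := 2 ^ j.+1.
Let m := 2 ^ j.
Let ps w := pos s t sd j.+1 R w.
Let wd i := word s t j.+1 i ++ R.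
Let adj := @schreier_adj V n E.

Lemma act_wd i : act_seq (s, t) (wd i) = wd i.+1.
Proof. by rewrite act_cat act_word // act_R // if_same. Qed.

Lemma pos_act_edge f (w : n.-tuple V) : f \in E ->
  ps (act_tuple f w) = ps w \/ wd (ps w) = w /\ wd (ps w).+1 = act_tuple f w.
Proof.
move=> fE; have sw : size w = j.+1 + size R by rewrite size_tuple.
case: (eqVneq f (s, t)) => [->|ne]; last first.
  by left; apply: pos_act => //; apply: sd_edge.
have [|ww] := pos_act_st st sd_s sd_t R_stop sw; first by left.
by right; split=> //; rewrite -act_wd /wd ww.
Qed.

Lemma ncloser_orbit (u : n.-tuple V) i (v := act_tuple (s, t) u)
    (H := [set w : n.-tuple V | half_arc m i (ps w)]) :
  i < M -> wd i = u -> ncloser adj u v = #|H| /\ ncloser adj v u = #|~: H|.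
Proof.
move=> iM ui; have m0 : 0 < m by rewrite expn_gt0.
have ME : M = 2 * m by rewrite /M expnS.
have psM (w : n.-tuple V) : ps w < M.
  by apply: pos_lt => //; rewrite size_tuple.
have ps_wd k : ps (wd k) = k %% M by apply: pos_word.
have wd_mod k l : k = l %[mod M] -> wd k = wd l.
  by move=> kl; rewrite /wd -(word_mod st _ k) -(word_mod st _ l) -/M kl.
(* The retraction followed by the reflection of the cycle that swaps positions [i] and [i + 1], that
   is [u] and [v]; [M] keeps the subtraction from truncating. *)
pose rho (w : n.-tuple V) := insubd u (wd (2 * i + 1 + M - ps w)).
have rhoE w : rho w = wd (2 * i + 1 + M - ps w) :> seq V.
  by rewrite val_insubd size_cat size_word -nE eqxx.
have rho_step (w : n.-tuple V) f : ps (act_tuple f w) = (ps w).+1 %% M ->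
    rho (act_tuple f w) = wd (2 * i + M - ps w) :> seq V.
  move=> psf; rewrite rhoE psf; have := psM w; move: (ps w) => y yM.
  rewrite modS_lt //; case: eqP => yM1; last by congr wd; lia.
  by apply: wd_mod; rewrite -[RHS]modnDr; congr modn; lia.
have rho_wd (w : n.-tuple V) : wd (2 * i + M - ps w).+1 = rho w.
  by rewrite rhoE; have := psM w => ?; congr wd; lia.
(* An edge outside the orbit keeps [ps] and collapses under [rho]; an orbit edge is mapped to an
   orbit edge with reversed direction, and to itself if it leaves [H]. *)
have step f (w : n.-tuple V) : f \in E ->
    (rho w = rho (act_tuple f w) \/ adj (rho (act_tuple f w)) (rho w)) /\
    ((w \in H) != (act_tuple f w \in H) ->
       rho w = act_tuple f w /\ rho (act_tuple f w) = w).
  move=> fE; have [psf|[ww wf]] := pos_act_edge w fE.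
    rewrite !inE psf eqxx; split=> //; left.
    by apply: val_inj; rewrite /= !rhoE psf.
  have psf : ps (act_tuple f w) = (ps w).+1 %% M by rewrite -wf ps_wd.
  split.
    right; apply/schreier_adjE; exists (s, t) => //; left.
    by apply: val_inj; rewrite /= rho_step // act_wd.
  rewrite !inE psf ME => cross.
  have := half_arc_cross m0 _ _ cross; rewrite -ME => /(_ iM (psM w)) eqm.
  split; apply: val_inj.
    transitivity (wd (ps w).+1); last exact: wf.
    rewrite /= -rho_wd; apply: wd_mod.
    by rewrite -addn1 -modnDml eqm modnDml addn1.
  transitivity (wd (ps w)); last exact: ww.
  by rewrite /= rho_step //; apply: wd_mod.
have connS : forall x y, connect adj x y by apply: schreier_connected.
apply: (ncloser_reflect connS (f := rho)).
- move=> x y /schreier_adjE[f fE [] <-].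
    by have [[|]] := step f x fE; [left | right; apply/orP; right].
  by have [[|]] := step f y fE; [left | right; apply/orP; left].
- move=> x y /schreier_adjE[f fE [] <-]; first by have [_] := step f x fE.
  by rewrite eq_sym; have [_ h] := step f y fE => /h[].
- by apply/orP; left; apply: schreier_act.
- by rewrite inE -ui ps_wd modn_small // half_arc_refl.
- by rewrite inE /= -ui act_wd ps_wd ME half_arc_succ // -ME.
Qed.
End Closer.

(** * Counting words *)

Local Open Scope ring_scope.

Section TupleSums.
Variables (T : finType) (A : nmodType).
Implicit Types F : seq T -> A.

Lemma sum_tuple0 F : \sum_(u : 0.-tuple T) F u = F [::].
Proof.
rewrite (bigD1 [tuple]) //= big1 ?addr0 // => u.
by case/eqP; rewrite (tuple0 u).
Qed.

Lemma sum_tuple_cons n F :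
  \sum_(u : n.+1.-tuple T) F u
  = \sum_(x : T) \sum_(w : n.-tuple T) F (x :: w).
Proof.
rewrite pair_big /=.
rewrite (reindex (fun q : T * n.-tuple T => [tuple of q.1 :: q.2])) //=.
exists (fun u => (thead u, [tuple of behead u])) => [[x w]|u] _.
  by congr pair; apply: val_inj.
by rewrite [RHS]tuple_eta; apply: val_inj.
Qed.

Lemma sum_tuple_cat a b F :
  \sum_(u : (a + b).-tuple T) F u
  = \sum_(v : a.-tuple T) \sum_(w : b.-tuple T) F (v ++ w).
Proof.
elim: a F => [|a IH] F.
  by rewrite (sum_tuple0 (fun v => \sum_(w : b.-tuple T) F (v ++ w))).
rewrite (@sum_tuple_cons (a + b)).
rewrite (sum_tuple_cons _ (fun v => \sum_(w : b.-tuple T) F (v ++ w))).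
by apply: eq_bigr => x _; rewrite (IH (fun w => F (x :: w))).
Qed.

Lemma sum_tuple_rcons n F :
  \sum_(u : n.+1.-tuple T) F u
  = \sum_(w : n.-tuple T) \sum_(x : T) F (rcons w x).
Proof.
have := sum_tuple_cat n 1 F; rewrite addn1 => ->; apply: eq_bigr => w _.
rewrite (sum_tuple_cons _ (fun r => F (w ++ r))); apply: eq_bigr => x _.
by rewrite (sum_tuple0 (fun r => F (w ++ x :: r))) cats1.
Qed.

End TupleSums.

(** Flipping the top bit gives the antipodal position, so for each [y] exactly one value of [c] lies
    in the half-arc. *)
Lemma half_arc_bits m i y (b c : bool) : (i < m)%N -> (y < m)%N ->
  half_arc m (i + m * b) (y + m * c) = if b == c then (y <= i)%N else (i < y)%N.
Proof.
by move=> im ym; rewrite /half_arc; case: b; case: c => /=; case: ifP; lia.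
Qed.

(** * Counting the words that retract onto a half-cycle *)

Section SideSums.
Variables (V : finType) (s t : V) (sd : pred V).
Hypotheses (st : s != t) (sd_s : sd s) (sd_t : ~~ sd t).

Lemma sum_const_D1 (P : pred V) z (c : rat) : P z ->
  \sum_(x | P x && (x != z)) c = (#|P|%:R - 1) * c.
Proof.
move=> Pz; have : \sum_(x in P) c = #|P|%:R * c by rewrite sumr_const mulr_natl.
by rewrite (bigD1 z) //= mulrBl mul1r => <-; rewrite [c + _]addrC addrK.
Qed.

Lemma sum_sides (G : V -> rat) (g : bool -> rat) :
  (forall x, ~~ clean s t x -> G x = g (sd x)) ->
  \sum_x G x
  = G s + G t + (#|sd|%:R - 1) * g true + (#|predC sd|%:R - 1) * g false.
Proof.
move=> Gg; rewrite (bigID sd) /=.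
rewrite (bigD1 s) //= [X in _ + X](bigD1 t) //=.
rewrite -(sum_const_D1 _ sd_s) -(@sum_const_D1 (predC sd) t _ sd_t).
rewrite (eq_bigr (fun=> g true)); last first.
  move=> x /andP[sx xs]; rewrite Gg ?sx // /clean /= negb_or xs.
  by apply: contraTneq sx => ->.
rewrite [X in _ + (_ + X)](eq_bigr (fun=> g false)); last first.
  move=> x /andP[sx xt]; rewrite Gg ?(negbTE sx) // /clean /= negb_or xt andbT.
  by apply: contraNneq sx => ->.
by rewrite addrACA addrA.
Qed.

Let p : rat := #|sd|%:R.
Let q : rat := #|predC sd|%:R.
Let k : rat := #|V|%:R.

Lemma card_sides : k = p + q.
Proof. by rewrite -natrD cardC. Qed.

Lemma sum_const_tuple n (x : rat) : \sum_(w : n.-tuple V) x = k ^+ n * x.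
Proof. by rewrite sumr_const -mulr_natl card_tuple natrX. Qed.

(** Words with another tail all sit at one constant point. With tail [R], the last letter of the
    prefix decides: an unclean one puts the word at the constant point of its side. *)
Lemma card_arc j R (l : bitseq) b n : size l = j -> n = (j.+1 + size R)%N ->
  #|[set w : n.-tuple V |
     half_arc (2 ^ j) (num (rcons l b)) (pos s t sd j.+1 R w)]|%:R
  = k ^+ j * (1 + (p - 1) * (all id l == b)%:R + (q - 1) * (~~ b)%:R)
    + k ^+ j.+1 * (k ^+ size R - 1)
      * (if stop_side sd R then all id l == b else ~~ b)%:R.
Proof.
move=> sl ->; set m := (2 ^ j)%N.
pose C (y : bitseq) : rat := (half_arc m (num (rcons l b)) (num y))%:R.
have lm : (num l < m)%N by rewrite /m -sl num_lt.
have C_rcons y c : size y = j ->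
    C (rcons y c)
    = (if b == c then (num y <= num l)%N else (num l < num y)%N)%:R.
  move=> sy; have ym : (num y < m)%N by rewrite /m -sy num_lt.
  by rewrite /C !num_rcons sl sy half_arc_bits.
(* The constant points are at positions 0 and [2 ^ j.+1 - 1]. *)
have C_nseq c : C (nseq j.+1 c) = (if c then all id l == b else ~~ b)%:R.
  rewrite -addn1 nseqD cats1 C_rcons ?size_nseq // num_nseq -num_true sl -/m.
  by congr (_%:R); move: lm; case: c; case: (b) => /=; lia.
rewrite -sum1_card natr_sum big_mkcond /=.
pose F (w : seq V) := C (if drop j.+1 w == R then proj s t sd (take j.+1 w)
                         else nseq j.+1 (stop_side sd R)).
transitivity (\sum_(w : (j.+1 + size R).-tuple V) F w).
  by apply: eq_bigr => w _; rewrite inE /F /C /pos /stop_side; case: ifP.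
rewrite sum_tuple_cat.
transitivity (\sum_(v : j.+1.-tuple V)
    (C (proj s t sd v) + (k ^+ size R - 1) * C (nseq j.+1 (stop_side sd R)))).
  apply: eq_bigr => v _.
  have FE (w : seq V) : F (v ++ w) = C (if w == R then proj s t sd v
                                         else nseq j.+1 (stop_side sd R)).
    by rewrite /F drop_size_cat ?take_size_cat ?size_tuple.
  rewrite (bigD1 (in_tuple R)) //= FE eqxx; congr (_ + _).
  transitivity (\sum_(w : (size R).-tuple V | w != in_tuple R)
      C (nseq j.+1 (stop_side sd R))).
    apply: eq_bigr => w /negbTE wR.
    by rewrite FE -[_ == R]/(w == in_tuple R) wR.
  have := sum_const_tuple (size R) (C (nseq j.+1 (stop_side sd R))).
  rewrite (bigD1 (in_tuple R)) //= => h.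
  by rewrite mulrBl -h mul1r [X in X - _]addrC addrK.
rewrite big_split /= sum_const_tuple C_nseq mulrA; congr (_ + _).
rewrite (sum_tuple_rcons _ (fun v => C (proj s t sd v))).
rewrite (eq_bigr (fun=>
  1 + (p - 1) * (all id l == b)%:R + (q - 1) * (~~ b)%:R)).
  by rewrite sum_const_tuple.
move=> w _; have sw : size (proj s t sd w) = j by rewrite size_proj size_tuple.
rewrite (@sum_sides _ (fun c => C (nseq j.+1 c))); last first.
  by move=> x xc; rewrite proj_rcons_unclean // size_tuple.
rewrite !C_nseq /=; congr (_ + _ + _).
(* The last letters [s] and [t] give antipodal positions, exactly one of them in the arc: together
   they contribute 1. *)
rewrite !(proj_rcons_clean st sd_s sd_t) ?/clean /= ?eqxx ?orbT //.
rewrite eq_sym (negbTE st) !C_rcons //.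
by case: (b) => /=; case: leqP; rewrite ?addr0 ?add0r.
Qed.

End SideSums.

Lemma sum_geometric (a b c d k : rat) n : k - 1 != 0 -> 2 * k - 1 != 0 ->
  \sum_(i < n) (a + b * k ^+ i + c * 2 ^+ i + d * (2 ^+ i * k ^+ i))
  = a * n%:R + b * (k ^+ n - 1) / (k - 1) + c * (2 ^+ n - 1)
    + d * (2 ^+ n * k ^+ n - 1) / (2 * k - 1).
Proof.
move=> k1 k2; elim: n => [|n IH].
  by rewrite big_ord0; field; rewrite ?k1 ?k2.
by rewrite big_ord_recr /= IH !exprS -natr1; field; rewrite ?k1 ?k2.
Qed.

Lemma sum_all_true n (x y : rat) :
  \sum_(l : n.-tuple bool) (if all id l then x else y) = x + (2 ^+ n - 1) * y.
Proof.
elim: n => [|n IH].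
  by rewrite (sum_tuple0 (fun l => if all id l then x else y)) /=; ring.
rewrite (sum_tuple_cons _ (fun l => if all id l then x else y)) big_bool /= IH.
by rewrite sum_const_tuple card_bool exprS; ring.
Qed.

(** * The contribution of one tree edge *)

Section EdgeSum.
Variables (V : finType) (E : {set V * V}) (s t : V) (sd : pred V).
Hypotheses (st : s != t) (sd_s : sd s) (sd_t : ~~ sd t).
Hypotheses (stE : (s, t) \in E).
Hypothesis sd_edge : forall f, f \in E -> f != (s, t) -> sd f.1 = sd f.2.
Hypothesis conn : forall x y, connect (adjG E) x y.

Let p : rat := #|sd|%:R.
Let q : rat := #|predC sd|%:R.
Let k : rat := #|V|%:R.

Fixpoint prefix (w : seq V) : bitseq :=
  if w is x :: w' then
    if clean s t x then (x == s) :: prefix w' else [::]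
  else [::].

Fixpoint stopper (w : seq V) : option bool :=
  if w is x :: w' then if clean s t x then stopper w' else Some (sd x)
  else None.

Lemma prefix_split w : exists a R,
  [/\ w = a ++ R, all (clean s t) a,
      fixed_by_st s t R,
      prefix w = map (pred1 s) a
    & stopper w = if R is z :: _ then Some (sd z) else None].
Proof.
elim: w => [|x w [a [R [wE ca cR pw sw]]]]; first by exists [::], [::].
have [cx|cx] := boolP (clean s t x).
  by exists (x :: a), R; rewrite /= cx wE -wE pw sw.
by exists [::], (x :: w); rewrite /= (negbTE cx).
Qed.

(** The last bit of [a] only exchanges the two half-cycles, and the product is symmetric in them.
    The halves separate the two constant points exactly when all earlier bits are 1; [h] then counts
    the half away from the stopper's side. An empty prefix means a loop. *)
Definition edge_term (N : rat) (a : bitseq) (o : option bool) : rat :=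
  if a is [::] then 0 else
  let c := k ^+ (size a).-1 in
  let h := if all id (take (size a).-1 a)
           then (if o == Some false then p else q) * c else c in
  h * (N - h).

Lemma edge_term_rcons N l b o : edge_term N (rcons l b) o =
  let c := k ^+ size l in
  let h := if all id l then (if o == Some false then p else q) * c else c in
  h * (N - h).
Proof.
have : take (size l) (rcons l b) = l by rewrite -cats1 take_size_cat.
rewrite /edge_term; case: (rcons l b) (size_rcons l b) => //= y w [->] /= ->.
by [].
Qed.

Let adj n := @schreier_adj V n E.

Lemma edge_termE n (u : n.-tuple V) :
  (if act_tuple (s, t) u != u then
     (ncloser (@adj n) u (act_tuple (s, t) u)
      * ncloser (@adj n) (act_tuple (s, t) u) u)%:R else 0)
  = edge_term (k ^+ n) (prefix u) (stopper u).
Proof.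
have [a [R [uE ca cR -> ->]]] := prefix_split u.
have actu : val (act_tuple (s, t) u) = act_seq (s, t) a ++ R.
  by rewrite /= uE act_cat (act_R cR) if_same.
case/lastP: a => [|a x] in uE ca actu *.
  by rewrite /= -val_eqE actu /= uE eqxx.
have -> : act_tuple (s, t) u != u.
  rewrite -val_eqE actu /= uE eqseq_cat ?size_act_seq // eqxx andbT.
  case: (rcons a x) (size_rcons a x) ca => //= y w _ /andP[/orP[]/eqP-> _].
    by rewrite eqxx eqseq_cons eq_sym (negbTE st).
  by rewrite [t == s]eq_sym (negbTE st) eqxx eqseq_cons (negbTE st).
set l := map (pred1 s) a; set b := x == s; pose j := size a.
have sl : size l = j by rewrite size_map.
have nE : n = (j.+1 + size R)%N.
  by rewrite -(size_tuple u) uE size_cat size_rcons.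
have lE : map (pred1 s) (rcons a x) = rcons l b by rewrite map_rcons.
have iM : (num (rcons l b) < 2 ^ j.+1)%N.
  by rewrite -sl -(size_rcons l b) num_lt.
have ui : word s t j.+1 (num (rcons l b)) ++ R = u.
  by rewrite uE -lE -(size_rcons a x) word_num.
have [-> ->] := ncloser_orbit st sd_s sd_t stE sd_edge conn cR nE iM ui.
have cH (H : {set n.-tuple V}) : #|~: H|%:R = k ^+ n - #|H|%:R :> rat.
  by rewrite /k -natrX -card_tuple -(cardsC H) natrD addrC addKr.
rewrite natrM cH (card_arc st sd_s sd_t b sl nE) lE -/k -/p -/q.
rewrite edge_term_rcons sl nE exprD exprS /k (card_sides sd) -/p -/q.
move: (_ ^+ j) => c.
rewrite /stop_side; case: (R) => [|z R'] /=.
  by rewrite expr0; case: (all id l); case: (b) => /=; ring.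
by move: (_ ^+ _) => r; case: (sd z); case: (all id l); case: (b) => /=; ring.
Qed.

(** Words are grouped by the length [j] of the clean prefix: the next letter is one of [p - 1] or
    [q - 1] others, and [n - j.+1] letters remain free. The last sum is over entirely clean
    words. *)
Lemma sum_prefix n (G : bitseq -> option bool -> rat) :
  \sum_(u : n.-tuple V) G (prefix u) (stopper u)
  = \sum_(j < n) k ^+ (n - j.+1) * (\sum_(l : j.-tuple bool)
      ((p - 1) * G l (Some true) + (q - 1) * G l (Some false)))
    + \sum_(l : n.-tuple bool) G l None.
Proof.
elim: n G => [|n IH] G.
  rewrite big_ord0 add0r (sum_tuple0 (fun u => G (prefix u) (stopper u))).
  by rewrite (sum_tuple0 (fun l => G l None)).
rewrite (sum_tuple_cons _ (fun u => G (prefix u) (stopper u))).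
rewrite (sum_sides sd_s sd_t (g := fun b => k ^+ n * G [::] (Some b)));
  last first.
  by move=> x /negbTE xc; rewrite /= xc sum_const_tuple.
have [cs ct] : clean s t s /\ clean s t t by rewrite /clean /= !eqxx orbT.
rewrite /= cs ct eqxx eq_sym (negbTE st).
rewrite (IH (fun a => G (true :: a))) (IH (fun a => G (false :: a))).
rewrite big_ord_recl /= subn1 /=.
rewrite (sum_tuple0 (fun l => (p - 1) * G l (Some true)
                              + (q - 1) * G l (Some false))).
rewrite (sum_tuple_cons _ (fun l => G l None)) big_bool /=.
under [in RHS]eq_bigr => i _.
  rewrite (sum_tuple_cons _ (fun l => (p - 1) * G l (Some true)
                              + (q - 1) * G l (Some false))) big_bool /=.
  rewrite mulrDr subSS; over.
rewrite big_split /= -/p -/q.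
by ring.
Qed.

Lemma card_gt1 : 1 < k.
Proof. by rewrite /k ltr1n; apply/card_gt1P; exists s, t. Qed.

(** Two bit words have all their first [n] bits equal to 1; the other [2 ^+ n.+1 - 2] share the
    value [c * (N - c)]. *)
Lemma sum_edge_term n N o :
  \sum_(l : n.+1.-tuple bool) edge_term N l o
  = let c := k ^+ n in let h := (if o == Some false then p else q) * c in
    2 * h * (N - h) + (2 ^+ n.+1 - 2) * c * (N - c).
Proof.
rewrite (sum_tuple_rcons _ (fun l => edge_term N l o)).
set c := k ^+ n => /=; set h := (if _ then _ else _) * c.
rewrite (eq_bigr (fun l : n.-tuple bool =>
  if all id l then 2 * h * (N - h) else 2 * c * (N - c))).
  by rewrite sum_all_true exprS /=; ring.
move=> l _; rewrite big_bool !edge_term_rcons size_tuple -/c /=.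
by case: (all id l); rewrite -/h; ring.
Qed.

Lemma edge_sum n (N : rat := k ^+ n) : (0 < n)%N ->
  \sum_(u : n.-tuple V) edge_term N (prefix u) (stopper u)
  = 2 * (k - 1) * (2 * k ^+ 2 - 2 * k - 1) / (k ^+ 3 * (2 * k - 1))
      * 2 ^+ n * k ^+ (2 * n)
    - 4 * (k - 1) / k ^+ 2 * n%:R * k ^+ (2 * n)
    + 4 * (k + 1) / k ^+ 3 * k ^+ (2 * n)
    - 4 * (k + 1) / (k * (2 * k - 1)) * k ^+ n
    + (4 / k ^+ 2 * n%:R * k ^+ (2 * n)
       - 2 * (k ^+ 2 + 2) / (k ^+ 3 * (k - 1)) * k ^+ (2 * n)
       + 2 * (k + 2) / (k ^+ 2 * (k - 1)) * k ^+ n) * (p * q).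
Proof.
case: n @N => // n N _; have k1 := card_gt1.
have k0 : k != 0 by lra.
have km1 : k - 1 != 0 by lra.
have k2 : 2 * k - 1 != 0 by lra.
have qE : q = k - p by rewrite /k (card_sides sd) -/p -/q addrC addKr.
(* The term of the empty prefix is split off: it comes from loops and vanishes. *)
rewrite (sum_prefix n.+1 (edge_term N)) big_ord_recl /=.
rewrite (sum_tuple0 (fun l => (p - 1) * edge_term N l (Some true)
                              + (q - 1) * edge_term N l (Some false))) /=.
rewrite !(mulr0, addr0) add0r sum_edge_term /=.
set C := k ^+ n; have NE : N = k * C by rewrite /N exprS.
(* [A] and [B] collect, up to the factor [C / k], the constant term and the coefficient of [k ^+ i]
   in the summand. With [q = k - p] both are affine in [p * q]. *)
pose A := N * (2 * (p - 1) * q + 2 * (q - 1) * p - 2 * (k - 2)).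
pose B := - 2 * (p - 1) * q ^+ 2 - 2 * (q - 1) * p ^+ 2 + 2 * (k - 2).
rewrite (eq_bigr (fun i : 'I_n => C / k * (A + B * k ^+ i
  + 2 * (k - 2) * N * 2 ^+ i + (- 2 * (k - 2)) * (2 ^+ i * k ^+ i))));
  last first.
  move=> i _; rewrite big_split /= -!mulr_sumr !sum_edge_term /= subSS.
  have -> : k ^+ (n - bump 0 i) = C / k / k ^+ i.
    rewrite /bump /= add1n /C; have := ltn_ord i; move: (i : nat) => m mn.
    rewrite -{2}(subnK mn) exprD exprS.
    by field; rewrite k0 expf_neq0.
  rewrite exprS /A /B; have ki : k ^+ i != 0 by rewrite expf_neq0.
  move: (k ^+ i) ki (2 ^+ i) => ki ki0 ti; rewrite qE.
  by field; rewrite k0 ki0.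
rewrite -mulr_sumr sum_geometric // mulnC exprM -/N (exprS 2) -/C.
move: (2 ^+ n) C NE => T C NE; rewrite /A /B qE NE -natr1.
by field; rewrite k0 km1 k2.
Qed.
End EdgeSum.

(** * Summation over the tree edges *)

Theorem theorem5p7 (V : finType) (E : {set V * V}) (n : nat) :
  is_oriented_tree E -> (0 < n)%N ->
  let k : rat := (#|V|)%:R in
  let N : rat := n%:R in
  (SzSchreier E n)%:R =
      2 * (k - 1) ^+ 2 * (2 * k ^+ 2 - 2 * k - 1) / (k ^+ 3 * (2 * k - 1))
        * 2 ^+ n * k ^+ (2 * n)
    - 4 * (k - 1) ^+ 2 / k ^+ 2 * N * k ^+ (2 * n)
    + 4 * (k + 1) * (k - 1) / k ^+ 3 * k ^+ (2 * n)
    - 4 * (k + 1) * (k - 1) / (k * (2 * k - 1)) * k ^+ n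
    + (4 / k ^+ 2 * N * k ^+ (2 * n)
       - 2 * (k ^+ 2 + 2) / (k ^+ 3 * (k - 1)) * k ^+ (2 * n)
       + 2 * (k + 2) / (k ^+ 2 * (k - 1)) * k ^+ n) * (SzTree E)%:R.
Proof.
move=> treeE n0 k N; case: (treeE) => irr _ conn _.
pose c1 := 4 / k ^+ 2 * N * k ^+ (2 * n)
       - 2 * (k ^+ 2 + 2) / (k ^+ 3 * (k - 1)) * k ^+ (2 * n)
       + 2 * (k + 2) / (k ^+ 2 * (k - 1)) * k ^+ n.
pose c0 := 2 * (k - 1) * (2 * k ^+ 2 - 2 * k - 1) / (k ^+ 3 * (2 * k - 1))
      * 2 ^+ n * k ^+ (2 * n)
    - 4 * (k - 1) / k ^+ 2 * N * k ^+ (2 * n)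
    + 4 * (k + 1) / k ^+ 3 * k ^+ (2 * n)
    - 4 * (k + 1) / (k * (2 * k - 1)) * k ^+ n.
rewrite -/c1.
(* Each edge contributes [c0 + c1 * (p * q)], and [p * q] is its own term in the Szeged index of the
   tree. *)
have edge e : e \in E ->
    \sum_(u : n.-tuple V | act_tuple e u != u)
      (ncloser (@schreier_adj V n E) u (act_tuple e u)
       * ncloser (@schreier_adj V n E) (act_tuple e u) u)%:R
    = c0 + c1 * (ncloser (adjG E) e.1 e.2 * ncloser (adjG E) e.2 e.1)%:R.
  move=> eE; have [-> ->] := ncloser_tree treeE eE.
  case: e eE => s t stE.
  have st : s != t by apply: contraTneq stE => ->.
  have sd_t := side_snd treeE stE; have sd_s := side_fst E (s, t).
  have sd_edge f : f \in E -> f != (s, t) ->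
      side E (s, t) f.1 = side E (s, t) f.2.
    exact: side_edge.
  rewrite big_mkcond /=.
  under eq_bigr do rewrite (edge_termE st sd_s sd_t stE sd_edge conn).
  rewrite (edge_sum st sd_s sd_t n0) natrM /c0 /c1 /N /k.
  have -> : #|[set x | side E (s, t) x]| = #|side E (s, t)|.
    by apply: eq_card => x; rewrite inE.
  have -> // : #|~: [set x | side E (s, t) x]| = #|predC (side E (s, t))|.
  by apply: eq_card => x; rewrite !inE.
have -> : (SzSchreier E n)%:R = c0 *+ #|E| + c1 * (SzTree E)%:R.
  rewrite /SzSchreier (exchange_big_dep (fun e => e \in E)) /=; last first.
    by move=> u e _ /andP[].
  rewrite natr_sum /SzTree natr_sum mulr_sumr -sumr_const -big_split /=.
  apply: eq_bigr => e eE; rewrite -(edge e eE) natr_sum.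
  by apply: eq_bigl => u; rewrite eE.
rewrite (card_tree treeE); congr (_ + _).
(* For empty [V] the predecessor truncates to 0 and is not [k - 1], but the powers of [k] vanish as
   [n] is positive. *)
have [V0|V0] := posnP #|V|.
  rewrite /k V0 mulr0n !expr0n; case: (n) n0 => // m _.
  by rewrite !mulnS /= !(mulr0, mul0r, subr0, addr0).
rewrite -mulr_natr -subn1 natrB // -/k /c0.
by ring.
Qed.
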